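(* Let $n\in\mathbb N$, $n\ge2$, and let $\varphi:\mathbb R\to\mathbb R$ be continuous such that $\lim_{x\to-\infty}\varphi(x)$ and $\lim_{x\to\infty}\varphi(x)$ exist and are finite and distinct. For every $d>0$ there exists $f\in\mathcal N_\varphi^2(\mathbb R^n)$ whose uniform distance from the collection $\mathcal N_\varphi^1(\mathbb R^n)$ is $d$, i.e. $$\inf_{g\in\mathcal N_\varphi^1(\mathbb R^n)}\ \sup_{x\in\mathbb R^n}|f(x)-g(x)|=d.$$
   Context: $\mathbb N=\{1,2,\ldots\}$. For a function $\varphi:\mathbb R\to\mathbb R$ define the real vector spaces of functions $\mathbb R^n\to\mathbb R$ $$\mathcal N_\varphi^1(\mathbb R^n):=\operatorname{span}\{x\mapsto\varphi(a\cdot x+b)\mid a\in\mathbb R^n,\ b\in\mathbb R\},$$ $$\mathcal N_\varphi^2(\mathbb R^n):=\operatorname{span}\{x\mapsto\varphi(f(x)+b)\mid f\in\mathcal N_\varphi^{1}(\mathbb R^n),\ b\in\mathbb R\},$$ where span is the $\mathbb R$-linear span and $a\cdot x$ is the Euclidean inner product. *)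

(* Defs.v *)
From mathcomp Require Import all_boot all_order all_algebra.
From mathcomp Require Import all_classical all_reals all_analysis.

Set Implicit Arguments.
Unset Strict Implicit.
Unset Printing Implicit Defensive.

Import Order.TTheory GRing.Theory Num.Theory.
Import numFieldNormedType.Exports.

Local Open Scope classical_set_scope.
Local Open Scope ring_scope.

Definition lspan (K : pzRingType) (V : lmodType K) (S : set V) : set V :=
  [set v | exists (m : nat) (c : 'I_m -> K) (s : 'I_m -> V),
    (forall i, S (s i)) /\ v = \sum_(i < m) c i *: s i].

Definition dotp (R : realType) (n : nat) (a x : 'rV[R]_n) : R :=
  \sum_(i < n) a 0 i * x 0 i.

Definition N1 (R : realType) (n : nat) (phi : R -> R) : set ('rV[R]_n -> R) :=
  lspan [set h | exists (a : 'rV[R]_n) (b : R),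
    h = (fun x => phi (dotp a x + b))].

Definition N2 (R : realType) (n : nat) (phi : R -> R) : set ('rV[R]_n -> R) :=
  lspan [set h | exists (f : 'rV[R]_n -> R) (b : R),
    N1 phi f /\ h = (fun x => phi (f x + b))].

Arguments N1 {R} n phi _.
Arguments N2 {R} n phi _.

(* Both are taken in the extended reals: real-valued [sup] and [inf] have
   default values on unbounded or empty sets. *)
Definition udist (R : realType) (T : Type) (f g : T -> R) : \bar R :=
  ereal_sup [set `|f x - g x|%:E | x in [set: T]].

Definition udist_to (R : realType) (T : Type) (f : T -> R)
    (A : set (T -> R)) : \bar R :=
  ereal_inf [set udist f g | g in A].

(* Main.v *)
(** Along a curve [r |-> +/- (r ^ 2, r)] in the plane of the first two
    coordinates, every [phi (a . x + b)] that is not constant there tends to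
    [lp] on one branch and to [lm] on the opposite one.  Hence the sum of the
    limits over the two branches is the same for this curve and for its mirror
    image [r |-> +/- (r ^ 2, - r)], and the same holds for all of [N1].  For
    [f = phi (c phi(x_1) + c phi(x_2) + b)] the difference of these sums is
    [phi (s + t) + phi (s - t) - 2 phi s], with [s] and [t] arbitrary, which is
    not always zero as [lm <> lp].  So the bounded function [f] is at a
    positive finite distance from [N1], and can be rescaled. *)
Require Import Defs.
From mathcomp Require Import all_boot all_order all_algebra.
From mathcomp Require Import all_classical all_reals all_analysis.
From mathcomp Require Import ring lra.

Import Order.TTheory GRing.Theory Num.Theory.
Import numFieldNormedType.Exports.

Local Open Scope classical_set_scope.
Local Open Scope ring_scope.

(** * Linear spans *)

Section span.
Context {K : pzRingType} {V : lmodType K}.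
Implicit Types (S P : set V) (u v : V) (k : K).

Lemma lspan_ind S P : P 0 -> (forall u v, P u -> P v -> P (u + v)) ->
  (forall k u, S u -> P (k *: u)) -> lspan S `<=` P.
Proof.
move=> P0 PD PS v [m [c [s [Ss ->]]]].
by apply: (big_ind P) => // i _; exact: PS.
Qed.

Lemma lspan_gen S : S `<=` lspan S.
Proof.
move=> u Su; exists 1%N, (fun=> 1), (fun=> u).
by split=> //; rewrite big_ord1 scale1r.
Qed.

Lemma lspanZ S k v : lspan S v -> lspan S (k *: v).
Proof.
move=> [m [c [s [Ss ->]]]]; exists m, (fun i => k * c i), s; split=> //.
by rewrite scaler_sumr; apply: eq_bigr => i _; rewrite scalerA.
Qed.

Lemma lspan2 S k l u v : S u -> S v -> lspan S (k *: u + l *: v).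
Proof.
move=> Su Sv; exists 2, (fun i => if i == ord0 then k else l),
  (fun i => if i == ord0 then u else v).
by split=> [i|]; [case: ifP | rewrite big_ord_recl big_ord1].
Qed.

Lemma lspan0 S : lspan S 0.
Proof. by exists 0, (fun=> 0), (fun=> 0); split=> [[]|]//; rewrite big_ord0. Qed.

End span.

(** * Homogeneity of the uniform distance *)

Section distance.
Context {R : realType} {T : Type}.
Implicit Types (f g : T -> R) (A : set (T -> R)).

Lemma udistZ (k : R) f g : 0 < k ->
  udist (k *: f) (k *: g) = (k%:E * udist f g)%E.
Proof.
move=> k0; rewrite /udist -ereal_sup_pZl// image_comp; congr ereal_sup.
apply: eq_imagel => x _ /=.
by rewrite -EFinM -[k in RHS]gtr0_norm// -normrM mulrBr.
Qed.

(** Since [A] is stable under scaling, [g] and [k *: g] range over the same set, so the factor [k]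
    comes out of the infimum. *)
Lemma udist_toZ (k : R) f A : 0 < k -> (forall l g, A g -> A (l *: g)) ->
  udist_to (k *: f) A = (k%:E * udist_to f A)%E.
Proof.
move=> k0 AZ; rewrite /udist_to -ereal_inf_pZl// image_comp; congr ereal_inf.
apply/seteqP; split=> _ /= [g Ag <-].
- exists (k^-1 *: g); first exact: AZ.
  by rewrite -udistZ// scalerA divff ?scale1r// gt_eqF.
- by exists (k *: g); [exact: AZ | rewrite udistZ].
Qed.

End distance.

(** * Functions with limits at both infinities, and their values along quadratics *)

Section sigmoid.
Context {R : realType} (phi : R -> R) (lm lp : R).
Context (phi_lm : phi x @[x --> -oo] --> lm).
Context (phi_lp : phi x @[x --> +oo] --> lp).

Lemma bounded_of_limits : continuous phi -> exists M, forall x, `|phi x| <= M.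
Proof.
move=> phi_cont.
have [A [_ HA]] : \forall x \near -oo, `|phi x| <= `|lm| + 1.
  by apply: cvgr_norm_le phi_lm _ _; rewrite ltrDl.
have [B [_ HB]] : \forall x \near +oo, `|phi x| <= `|lp| + 1.
  by apply: cvgr_norm_le phi_lp _ _; rewrite ltrDl.
have /compact_bounded[C [_ HC]] : compact (phi @` `[A, B]).

  apply: continuous_compact (@segment_compact _ _ _); exact: continuous_subspaceT.
exists (`|C| + `|lm| + `|lp| + 1) => x.
have C0 := normr_ge0 C; have m0 := normr_ge0 lm; have p0 := normr_ge0 lp.
have [xA|Ax] := ltP x A; first by have := HA x xA; lra.
have [Bx|xB] := ltP B x; first by have := HB x Bx; lra.
have: `|phi x| <= `|C| + 1.
  apply: HC; first by rewrite (le_lt_trans (ler_norm C))// ltrDl.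
  by exists x => //=; rewrite in_itv/= Ax xB.
lra.
Qed.

(* Otherwise [t --> +oo] gives [lp + lm = 2 * phi s] for all [s], so that
   [phi] is constant. *)
Lemma not_midpoint_affine : lm <> lp ->
  exists s t, phi (s + t) + phi (s - t) - 2 * phi s != 0.
Proof.
move=> lmp; apply: contrapT => H.
have phiE s : phi s = (lp + lm) / 2.
  have E t : phi (s + t) + phi (s - t) = 2 * phi s.
    apply/eqP; rewrite -subr_eq0; apply/negPn/negP => nz.
    by apply: H; exists s, t.
  have Lp : phi (s + t) @[t --> +oo] --> lp.
    apply: cvg_comp phi_lp; apply/cvgryPge => A; near=> t.
    by rewrite -lerBlDl; near: t; apply: nbhs_pinfty_ge; rewrite num_real.
  have Lm : phi (s - t) @[t --> +oo] --> lm.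
    apply: cvg_comp phi_lm; apply/cvgrNyPle => A; near=> t.
    by rewrite lerBlDr -lerBlDl; near: t; apply: nbhs_pinfty_ge; rewrite num_real.
  have L : phi (s + t) + phi (s - t) @[t --> +oo] --> lp + lm by exact: cvgD.
  have -> : lp + lm = 2 * phi s.
    by apply: cvg_unique L _ => //; rewrite (funext E); exact: cvg_cst.
  by rewrite mulrC mulKf// pnatr_eq0.
apply: lmp.
have -> : lm = (lp + lm) / 2.
  apply: cvg_unique phi_lm _ => //; rewrite (funext phiE); exact: cvg_cst.
have {2}-> : lp = (lp + lm) / 2.
  apply: cvg_unique phi_lp _ => //; rewrite (funext phiE); exact: cvg_cst.
by [].
Unshelve. all: by end_near. Qed.

Lemma quadratic_cvgy (a e b : R) : 0 < a \/ (a = 0 /\ 0 < e) ->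
  a * r ^+ 2 + e * r + b @[r --> +oo] --> +oo.
Proof.
move=> H; apply/cvgryPge => A; near=> r.
have r1 : 1 <= r by near: r; apply: nbhs_pinfty_ge; rewrite num_real.
case: H => [a0|[-> e0]].
  (* This bound gives [a * r + e >= |A - b|]; multiplying by [r >= 1] yields
     [a * r ^+ 2 + e * r >= A - b]. *)
  have : (`|A - b| + `|e|) / a <= r by near: r; apply: nbhs_pinfty_ge; rewrite num_real.
  rewrite ler_pdivrMr// => h.
  have := ler_norm (A - b); have := normr_ge0 (A - b).
  have := ler_norm (- e); rewrite normrN; nra.
have : (A - b) / e <= r by near: r; apply: nbhs_pinfty_ge; rewrite num_real.
by rewrite ler_pdivrMr// => h; lra.
Unshelve. all: by end_near. Qed.

Let even_sum_cvg_pos (a e b : R) : 0 < a \/ (a = 0 /\ 0 < e) ->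
  phi (a * r ^+ 2 + e * r + b) + phi (- (a * r ^+ 2 + e * r) + b)
    @[r --> +oo] --> lp + lm.
Proof.
move=> ae; apply: cvgD; first exact: cvg_comp (quadratic_cvgy _ _ b ae) phi_lp.
apply: cvg_comp phi_lm; apply/cvgNry.
apply: cvg_trans (quadratic_cvgy _ _ (- b) ae).
by apply: near_eq_cvg; near=> r; rewrite /= fctE; ring.
Unshelve. all: by end_near. Qed.

(** The limit depends on [e] only through [e == 0], hence is unchanged when [e] becomes [- e]; this
    sign change is the passage to the mirror curve. *)
Lemma even_sum_cvg (a e b : R) :
  phi (a * r ^+ 2 + e * r + b) + phi (- (a * r ^+ 2 + e * r) + b)
    @[r --> +oo] -->
  if (a == 0) && (e == 0) then 2 * phi b else lp + lm.
Proof.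
case: ifPn => [/andP[/eqP-> /eqP->]|ae].
  under eq_fun do rewrite !mul0r addr0 oppr0 add0r -mulr2n -mulr_natl.
  exact: cvg_cst.
(* Up to replacing [(a, e)] by [(- a, - e)], which only swaps the two summands, the quadratic tends
   to [+oo]. *)
have [p|n] : (0 < a \/ (a = 0 /\ 0 < e)) \/ (0 < - a \/ (- a = 0 /\ 0 < - e)).
- rewrite !oppr_gt0; move: ae; rewrite negb_and.
  have [a0|a0|->] := ltgtP a 0; [by right; left|by left; left|].
  rewrite /= oppr0.
  by case: (ltgtP e 0) => // e0 _; [right; right|left; right].
- exact: even_sum_cvg_pos.
- apply: cvg_trans (even_sum_cvg_pos _ _ b n); apply: near_eq_cvg; near=> r.
  rewrite [RHS]addrC; congr (phi _ + phi _); ring.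
Unshelve. all: by end_near. Qed.

End sigmoid.

(** * The parabola in the first two coordinates and its mirror image *)

Section plane.
Context {R : realType} {n : nat}.
Implicit Types (h : 'rV[R]_n.+2 -> R) (x y r : R).

Let i1 : 'I_n.+2 := lift ord0 ord0.

Definition planar_point x y : 'rV[R]_n.+2 :=
  \row_i (if i == ord0 then x else if i == i1 then y else 0).

Lemma dotp_planar_point (a : 'rV[R]_n.+2) x y :
  dotp a (planar_point x y) = a 0 ord0 * x + a 0 i1 * y.
Proof.
rewrite /dotp big_ord_recl big_ord_recl !mxE/= big1 ?addr0// => i _.
by rewrite !mxE/= mulr0.
Qed.

Definition even_gap h r : R :=
  h (planar_point (r ^+ 2) r) + h (planar_point (- r ^+ 2) (- r)) -
  (h (planar_point (r ^+ 2) (- r)) + h (planar_point (- r ^+ 2) r)).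

Lemma even_gapD h1 h2 r : even_gap (h1 + h2) r = even_gap h1 r + even_gap h2 r.
Proof. by rewrite /even_gap !fctE; ring. Qed.

Lemma even_gapZ k h r : even_gap (k *: h) r = k * even_gap h r.
Proof.
have kh z : (k *: h) z = k * h z by [].
by rewrite /even_gap !kh; ring.
Qed.

(** The gap is a signed sum of four values, so functions within [e] of each other have gaps within
    [4 * e]. *)
Lemma udist_ge_even_gap h g (l : R) :
  even_gap h r @[r --> +oo] --> l -> even_gap g r @[r --> +oo] --> 0 ->
  ((`|l| / 4)%:E <= udist h g)%E.
Proof.
move=> hl g0; rewrite leNgt; apply/negP => lt.
have lt' z : (`|h z - g z|%:E <= udist h g)%E.
  by apply: ereal_sup_ubound; exists z.
(* The distance may be infinite in general; here the negated goal bounds it above, and any single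
   value bounds it below. *)
have ud : udist h g \is a fin_num.
  rewrite fin_numE; apply/andP; split; last by rewrite lt_eqF// (lt_trans lt) ?ltry.
  rewrite gt_eqF// (lt_le_trans _ (lt' 0))//; exact: ltNyr.
move: lt lt'; rewrite -(fineK ud) lte_fin; set e := fine _ => el bnd.
have {}bnd z : `|h z - g z| <= e by rewrite -lee_fin.
have : `|even_gap h r - even_gap g r| @[r --> +oo] --> `|l - 0|.
  by apply: cvg_norm; exact: cvgB.
rewrite subr0 => /cvgr_gt /(_ (4 * e)) H.
have /H/filter_ex[r] : 4 * e < `|l| by lra.
have := bnd (planar_point (r ^+ 2) r).
have := bnd (planar_point (- r ^+ 2) (- r)).
have := bnd (planar_point (r ^+ 2) (- r)).
have := bnd (planar_point (- r ^+ 2) r).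
rewrite !ler_norml => /andP[? ?] /andP[? ?] /andP[? ?] /andP[? ?].
by rewrite /even_gap ltr_normr => /orP[]; lra.
Qed.

Context (phi : R -> R) (lm lp : R).
Context (phi_lm : phi x @[x --> -oo] --> lm).
Context (phi_lp : phi x @[x --> +oo] --> lp).

Lemma even_gap_N1_cvg0 g : N1 n.+2 phi g -> even_gap g r @[r --> +oo] --> 0.
Proof.
apply: (@lspan_ind _ _ _ [set h | even_gap h r @[r --> +oo] --> 0]) => /=.
- under eq_fun do rewrite /even_gap !subrr. exact: cvg_cst.
- move=> u v u0 v0; under eq_fun do rewrite even_gapD.
  by rewrite -[0]addr0; exact: cvgD.
move=> k _ [a [b ->]]; under eq_fun do rewrite even_gapZ.
rewrite -(mulr0 k); apply: cvgM; [exact: cvg_cst | rewrite /even_gap].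
pose q := even_sum_cvg _ _ _ phi_lm phi_lp.
(* The curve and its mirror image give the linear coefficients [a 0 i1] and [- a 0 i1]; both vanish
   or neither does, so the two limits cancel. *)
have := cvgB (q (a 0 ord0) (a 0 i1) b) (q (a 0 ord0) (- a 0 i1) b).
rewrite oppr_eq0 subrr => /(_ _); apply: cvg_trans.
apply: near_eq_cvg; near=> r; rewrite !fctE !dotp_planar_point.
by congr (phi _ + phi _ - (phi _ + phi _)); ring.
Unshelve. all: by end_near. Qed.

End plane.

Theorem theorem2p4 (R : realType) (n : nat) (hn : (2 <= n)%N)
    (phi : R -> R) (phi_cont : continuous phi)
    (lm lp : R) (phi_lm : phi x @[x --> -oo] --> lm)
    (phi_lp : phi x @[x --> +oo] --> lp) (lm_neq_lp : lm <> lp)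
    (d : R) (d_gt0 : 0 < d) :
  exists f : 'rV[R]_n -> R,
    N2 n phi f /\ udist_to f (N1 n phi) = d%:E.
Proof.
case: n hn => [|[|n]]// _.
have [s [t st]] := not_midpoint_affine _ _ _ phi_lm phi_lp lm_neq_lp.
set D := _ - _ in st.
(* [c] and [b] are chosen so that [c * (2 * lp) + b = s + t],
   [c * (2 * lm) + b = s - t] and hence [c * (lp + lm) + b = s]. *)
pose c := t / (lp - lm); pose b := s - c * (lp + lm).
pose e1 : 'rV[R]_n.+2 := planar_point 1 0.
pose e2 : 'rV[R]_n.+2 := planar_point 0 1.
pose f0 : 'rV[R]_n.+2 -> R := c *: (fun x => phi (dotp e1 x + 0)) +
  c *: (fun x => phi (dotp e2 x + 0)).
pose f := fun x => phi (f0 x + b).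
have N2f : N2 n.+2 phi f.
  apply: lspan_gen; exists f0, b; split=> //.
  by apply: lspan2; [exists e1, 0 | exists e2, 0].
have f0E x y : f0 (planar_point x y) = c * phi x + c * phi y.
  suff E : f0 (planar_point x y) =
      c * phi (dotp e1 (planar_point x y) + 0) +
      c * phi (dotp e2 (planar_point x y) + 0).
    by rewrite E !dotp_planar_point !mxE/= !mul1r !mul0r !addr0 add0r.
  by [].
have gapf : even_gap f r @[r --> +oo] --> D.
  (* At each of the four points of the gap, both coordinates tend to an infinity, so [l] and [m] are
     each [lp] or [lm]; continuity of [phi] carries the limit through the outer layer. *)
  have corner (u v : R -> R) (l m : R) : phi (u r) @[r --> +oo] --> l ->
      phi (v r) @[r --> +oo] --> m ->
      f (planar_point (u r) (v r)) @[r --> +oo] --> phi (c * l + c * m + b).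
    move=> ul vm; rewrite /f; under eq_fun do rewrite f0E.
    apply: continuous_cvg; first exact: phi_cont.
    apply: cvgD; last exact: cvg_cst.
    by apply: cvgD; apply: cvgM => //; exact: cvg_cst.
  have sq_y : (r : R) ^+ 2 @[r --> +oo] --> +oo.
    rewrite [X in X @ _](_ : _ = fun r : R => 1 * r ^+ 2 + 0 * r + 0).
      by apply: quadratic_cvgy; left.
    by apply/funext => r; ring.
  have P1 : phi (r ^+ 2) @[r --> +oo] --> lp by exact: cvg_comp phi_lp.
  have P2 : phi (- r ^+ 2) @[r --> +oo] --> lm.
    by apply: cvg_comp phi_lm; apply/cvgNrNy.
  have P3 : phi (- r) @[r --> +oo] --> lm.
    by apply: cvg_comp phi_lm; rewrite ninfty.
  have nz : lp - lm != 0 by rewrite subr_eq0 eq_sym; exact/eqP.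
  have -> : D = phi (c * lp + c * lp + b) + phi (c * lm + c * lm + b) -
      (phi (c * lp + c * lm + b) + phi (c * lm + c * lp + b)).
    rewrite /D mulr2n mulrDl mul1r.
    by congr (phi _ + phi _ - (phi _ + phi _)); rewrite /b /c; field.
  apply: cvgB; apply: cvgD; exact: corner.
have lower : ((`|D| / 4)%:E <= udist_to f (N1 n.+2 phi))%E.
  apply: le_ereal_inf_tmp => _ [g Ng <-].
  apply: udist_ge_even_gap gapf _.
  exact: even_gap_N1_cvg0 _ _ _ phi_lm phi_lp _ Ng.
have [M phiM] := bounded_of_limits _ _ _ phi_lm phi_lp phi_cont.
have upper : (udist_to f (N1 n.+2 phi) <= M%:E)%E.
  (* The zero function is a competitor in the infimum, and [f] takes values of [phi] only. *)
  apply: ge_ereal_inf; exists (udist f 0); first by exists 0; [exact: lspan0|].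
  by apply: ge_ereal_sup => _ [x _ <-]; rewrite lee_fin subr0; exact: phiM.
have D0 : 0 < `|D| / 4 by rewrite divr_gt0// normr_gt0.
have uf : udist_to f (N1 n.+2 phi) \is a fin_num.
  apply/fin_numPlt; rewrite (lt_le_trans _ lower) ?ltNyr//=.
  by rewrite (le_lt_trans upper) ?ltry.
move: lower; rewrite -(fineK uf) lee_fin; set u := fine _ => lower.
have u0 : 0 < u by exact: lt_le_trans lower.
(* Both [N1] and [N2] are stable under scaling, so the factor [d / u] turns the positive finite
   distance [u] into [d]. *)
exists ((d / u) *: f); split; first exact: lspanZ.
rewrite udist_toZ ?divr_gt0//; last by move=> k g; exact: lspanZ.
by rewrite -(fineK uf) -EFinM divfK// gt_eqF.
Qed.
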